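(* Let $G$ be a compactly covered locally compact topologically quasihamiltonian group and $\phi$ a continuous endomorphism of $G$. Then $h_{alg}(\phi^m)=m\cdot h_{alg}(\phi)$ for every natural number $m\geq 0$ (with $\phi^0=id_G$ and the convention $0\cdot\infty=0$).
   Context: All topological groups are Hausdorff. A topological group is compactly covered if each of its elements lies in a compact subgroup. A closed subgroup $N$ of a topological group $G$ is topologically quasinormal if $\overline{NL}=\overline{LN}$ for every closed subgroup $L$ of $G$; $G$ is topologically quasihamiltonian if every closed subgroup of $G$ is topologically quasinormal. Algebraic entropy: let $G$ be a locally compact group with right Haar measure $\mu$ and $\phi$ a continuous endomorphism of $G$. For $U\subseteq G$ and $n\geq 1$ put $T_n(\phi,U)=U\cdot\phi(U)\cdots\phi^{n-1}(U)$. For $U$ a compact neighborhood of $e_G$ put $H_{alg}(\phi,U)=\limsup_{n\to\infty}\frac{\log\mu(T_n(\phi,U))}{n}$, and let $h_{alg}(\phi)\in[0,\infty]$ be the supremum of $H_{alg}(\phi,U)$ over all compact neighborhoods $U$ of $e_G$. *)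

(* Defs.v *)
From HB Require Import structures.
From mathcomp Require Import all_boot all_order all_algebra.
From mathcomp Require Import all_classical all_reals all_analysis.

Set Implicit Arguments.
Unset Strict Implicit.
Unset Printing Implicit Defensive.

Import Order.TTheory GRing.Theory Num.Theory.

Local Open Scope classical_set_scope.
Local Open Scope ring_scope.

(* The point of the underlying ptopologicalType plays no role and need not be
   the identity; it is there because g_sigma_algebraType expects a
   pointedType. *)
HB.mixin Record PointedTopological_isTopologicalGroup G
    & PointedTopological G & Group G := {
  mulg_continuous : continuous (fun x : G * G => (x.1 * x.2)%g) ;
  invg_continuous : continuous (fun x : G => (x^-1)%g)
}.

#[short(type="topologicalGroupType")]
HB.structure Definition TopologicalGroup :=
  {G of PointedTopological G & Group G
      & PointedTopological_isTopologicalGroup G}.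

Section topological_groups.
Context {G : topologicalGroupType}.
Implicit Types (A B K L N : set G).

Definition setMg A B : set G := [set (x * y)%g | x in A & y in B].

Definition subgroup K :=
  [/\ K 1%g, (forall x y, K x -> K y -> K (x * y)%g)
    & (forall x, K x -> K (x^-1)%g)].

Definition closed_subgroup K := subgroup K /\ closed K.

Definition compactly_covered :=
  forall x : G, exists K, [/\ subgroup K, compact K & K x].

Definition topologically_quasinormal N :=
  closed_subgroup N /\
  forall L, closed_subgroup L -> closure (setMg N L) = closure (setMg L N).

Definition topologically_quasihamiltonian :=
  forall N, closed_subgroup N -> topologically_quasinormal N.

End topological_groups.

Arguments compactly_covered : clear implicits.
Arguments topologically_quasihamiltonian : clear implicits.

Notation borel G := (g_sigma_algebraType (@open G)).

Section algebraic_entropy.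
Context {R : realType} {G : topologicalGroupType}.
Local Open Scope ereal_scope.

(* A nonzero right-invariant Radon measure on the Borel sigma-algebra. *)
Record right_haar_measure (mu : {measure set (borel G) -> \bar R}) : Prop := {
  haar_neq0 : mu setT != 0 ;
  haar_compact_fin : forall K : set G, compact K -> mu K < +oo ;
  haar_outer_regular : forall A : set (borel G), measurable A ->
    mu A = ereal_inf [set mu U | U in [set U : set G | open U /\ A `<=` U]] ;
  haar_inner_regular : forall U : set G, open U ->
    mu U = ereal_sup [set mu K | K in [set K : set G | compact K /\ K `<=` U]] ;
  haar_right_invariant : forall (A : set (borel G)) (x : G), measurable A ->
    mu [set ((a : G) * x)%g | a in A] = mu A
}.

Fixpoint trajectory (phi : G -> G) (U : set G) (n : nat) : set G :=
  if n is n'.+1 then setMg (trajectory phi U n') (iter n' phi @` U)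
  else [set 1%g].

Variable mu : {measure set (borel G) -> \bar R}.

(* The sequence starts at the trajectory of length 1, whence the successors. *)
Definition Halg (phi : G -> G) (U : set G) : \bar R :=
  limn_esup (fun n => lne (mu (trajectory phi U n.+1)) * (n.+1%:R^-1)%:E).

Definition halg (phi : G -> G) : \bar R :=
  ereal_sup [set Halg phi U | U in [set U : set G | compact U /\ nbhs 1%g U]].

End algebraic_entropy.

(* Main.v *)
Require Import Defs.
From HB Require Import structures.
From mathcomp Require Import all_boot all_order all_algebra.
From mathcomp Require Import all_classical all_reals all_analysis.

Set Implicit Arguments.
Unset Strict Implicit.
Unset Printing Implicit Defensive.

Import Order.TTheory GRing.Theory Num.Theory.
Import numFieldNormedType.Exports.

Local Open Scope classical_set_scope.
Local Open Scope ring_scope.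

(** Write T_n(phi, U) for the trajectory of U, and let U be a compact
    neighbourhood of the identity.

    For m > 0 the proof rests on the set identity
    T_n(phi^m, T_m(phi, U)) = T_(nm)(phi, U) ([trajectory_iter]), which holds
    because consecutive blocks of m factors of U phi(U) phi^2(U) ... are the
    images of the first block under phi^m, phi^(2m), .... The sequence
    a_k = log mu(T_k(phi, U)) is real and nondecreasing, since U contains 1 and
    0 < mu(T_k) < +oo, and for such a sequence the upper limit of a_k / k is
    already reached along the multiples of m ([limn_esup_multiples]). Hence
    H(phi^m, T_m(phi, U)) = m H(phi, U) ([Halg_iter]). As U is contained in
    T_m(phi, U), which is again a compact neighbourhood of 1, taking suprema
    over U gives both inequalities.

    For m = 0 the claim is that the identity has entropy 0. A compact subgroup
    H which is a neighbourhood of 1 satisfies T_n(id, H) = H and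
    0 < mu(H) < +oo, so H(id, H) = lim log mu(H) / n = 0
    ([Halg_id_subgroup]); by monotonicity of H(id, U) in U it suffices that
    every compact set lies in a compact open subgroup
    ([compact_sub_open_subgroup]). In a topologically quasihamiltonian group
    the product of two compact subgroups is a compact subgroup, because compact
    sets are closed and the closures may be dropped from the commutation
    relation; compact covering then puts every finite set in a compact
    subgroup, and a covering argument extends this to compact sets. *)

(** * Upper limits along multiples *)

Section limsup.
Context {R : realType}.
Implicit Types (u v : (\bar R)^nat) (x : \bar R).
Local Open Scope ereal_scope.

Lemma limn_esup_le u x : (\forall n \near \oo, u n <= x) -> limn_esup u <= x.
Proof.
move=> ux; apply: ge_ereal_inf; exists (ereal_sup (u @` [set n | u n <= x])).
  by exists [set n | u n <= x].
by apply: ge_ereal_sup => _ [n /= unx <-].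
Qed.

Lemma near_limn_esup_lt u x :
  limn_esup u < x -> \forall n \near \oo, u n <= x.
Proof.
move=> /ereal_inf_lt[_ [V /= Voo <-]] supVx.
apply: filterS Voo => n Vn; apply: le_trans (ltW supVx).
by apply: ereal_sup_ubound; exists n.
Qed.

(** Upper limits are compared through the real numbers that eventually bound
    the sequence, which treats finite and infinite limits uniformly. *)
Lemma le_limn_esupP x v :
  (forall r : R, (\forall n \near \oo, v n <= r%:E) -> x <= r%:E) ->
  x <= limn_esup v.
Proof.
move=> xv; have lt_r r : limn_esup v < r%:E -> x <= r%:E.
  by move=> /near_limn_esup_lt /xv.
move: lt_r; case: (limn_esup v) => [s| |] lt_r; last 2 first.
- exact: leey.
- case: x {xv} lt_r => [s lt_r| lt_r|_] //.
  + by have := lt_r (s - 1)%R (ltNyr _); rewrite lee_fin lerDl oppr_ge0 ler10.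
  + by have := lt_r 0%R (ltNyr _); rewrite leye_eq.
by apply/lee_addgt0Pr => e e0; apply: lt_r; rewrite lte_fin ltrDl.
Qed.

Lemma le_limn_esup u v :
  (\forall n \near \oo, u n <= v n) -> limn_esup u <= limn_esup v.
Proof.
move=> uv; apply: le_limn_esupP => r vr; apply: limn_esup_le.
by apply: filterS2 uv vr => n; exact: le_trans.
Qed.

(** An index k is at most the next multiple of [m], which exceeds it by less
    than [m]; monotonicity bounds [a k] by the value of [a] there, and after
    division by k the overshoot disappears in the limit. *)
Lemma limn_esup_multiples (a : nat -> R) (m : nat) : (0 < m)%N ->
  (forall i j, (0 < i <= j)%N -> (a i <= a j)%R) ->
  limn_esup (fun n => (a (n.+1 * m)%N * n.+1%:R^-1)%:E) =
  m%:R%:E * limn_esup (fun n => (a n.+1 * n.+1%:R^-1)%:E).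
Proof.
move=> m0 amono; have mR : (0 < m%:R :> R)%R by rewrite ltr0n.
apply/eqP; rewrite eq_le; apply/andP; split.
  rewrite -lee_pdivrMl //; apply: le_limn_esupP => r ar.
  rewrite lee_pdivrMl // -EFinM; apply: limn_esup_le.
  case: ar => N _ ar; exists N => // n /= Nn.
  have := ar (n.+1 * m).-1; rewrite /= prednK ?muln_gt0 //.
  have le_nm : (n.+1 <= n.+1 * m)%N by rewrite leq_pmulr.
  have le_Nnm : (N <= (n.+1 * m).-1)%N.
    by apply: leq_trans Nn _; rewrite -ltnS prednK // muln_gt0.
  move=> /(_ le_Nnm); rewrite !lee_fin !ler_pdivrMr ?ltr0n ?muln_gt0 //.
  by rewrite natrM (mulrC _ m%:R) mulrA (mulrC r).
apply: le_limn_esupP => r ar; rewrite -lee_pdivlMl // -EFinM.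
set s := (m%:R^-1 * r)%R.
have rE : r = (s * m%:R)%R by rewrite /s mulrC mulVKf ?gt_eqF.
apply/lee_addgt0Pr => e e0; apply: limn_esup_le.
case: ar => N _ ar.
near=> n.
have le_Nn : (N * m <= n)%N by near: n; exact: nbhs_infty_ge.
have le_sn : (`|s| * m%:R / e <= n%:R)%R by near: n; exact: nbhs_infty_ger.
have := ar (n %/ m)%N; rewrite /= leq_divRL // => /(_ le_Nn).
rewrite -EFinD !lee_fin !ler_pdivrMr ?ltr0n // => leq.
(* q.+1 * m is the multiple of m that follows n, hence at least n.+1. *)
set q := (n %/ m)%N in leq *.
have ltnq : (n < q.+1 * m)%N by rewrite ltn_ceil.
have leqn : (q * m <= n)%N by rewrite leq_divM.
have := amono n.+1 (q.+1 * m)%N; rewrite ltnq => /(_ isT) aq.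
apply: le_trans aq _; apply: le_trans leq _.
rewrite rE -mulrA mulrDl -natrM mulnC -lerBlDl -mulrBr -natrB //.
(* The absolute value covers negative s, where the overshoot has the good
   sign. *)
apply: (@le_trans _ _ (`|s| * m%:R)%R).
  apply: (@le_trans _ _ (`|s| * (q.+1 * m - n.+1)%:R)%R).
    by rewrite ler_wpM2r // ler_norm.
  by rewrite ler_wpM2l // ler_nat leq_subLR mulSnr leq_add2r leqW.
rewrite ler_pdivrMr // in le_sn.
apply: le_trans le_sn _.
by rewrite mulrC; apply: ler_wpM2l; [exact: ltW|rewrite ler_nat].
Unshelve. all: by end_near. Qed.

End limsup.

(** * Products of sets and compact subgroups *)

Section groups.
Context {G : topologicalGroupType}.
Implicit Types (A B C K L U V : set G) (x y : G).
Local Open Scope group_scope.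

Lemma setMgS A B A' B' :
  A `<=` A' -> B `<=` B' -> setMg A B `<=` setMg A' B'.
Proof.
move=> AA BB _ [x Ax [y By <-]].
by exists x; [exact: AA|exists y; [exact: BB|]].
Qed.

Lemma setMg1A A : setMg [set 1] A = A.
Proof.
apply/seteqP; split=> [_ [_ -> [y Ay <-]]|y Ay]; first by rewrite mul1g.
by exists 1 => //; exists y => //; rewrite mul1g.
Qed.

Lemma setMgA A B C : setMg A (setMg B C) = setMg (setMg A B) C.
Proof.
apply/seteqP; split.
  move=> _ [x Ax [_ [y By [z Cz <-]] <-]]; exists (x * y).
    by exists x => //; exists y.
  by exists z => //; rewrite mulgA.
move=> _ [_ [x Ax [y By <-]] [z Cz <-]]; exists x => //; exists (y * z).
  by exists y => //; exists z.
by rewrite mulgA.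
Qed.

Lemma image_setMg (f : G -> G) A B : {morph f : x y / x * y} ->
  f @` setMg A B = setMg (f @` A) (f @` B).
Proof.
move=> fM; apply/seteqP; split.
  move=> _ [_ [x Ax [y By <-]] <-]; exists (f x); first by exists x.
  by exists (f y); [exists y|rewrite fM].
move=> _ [_ [x Ax <-] [_ [y By <-] <-]]; exists (x * y); last exact: fM.
by exists x => //; exists y.
Qed.

Lemma setMgE A B : setMg A B = (fun z : G * G => z.1 * z.2) @` (A `*` B).
Proof.
apply/seteqP; split=> [_ [x Ax [y By <-]]|_ [[x y] [/= Ax By] <-]].
  by exists (x, y).
by exists x => //; exists y.
Qed.

Lemma compact_setMg A B : compact A -> compact B -> compact (setMg A B).
Proof.
move=> cA cB; rewrite setMgE; apply: continuous_compact.
  by apply: continuous_subspaceT; exact: mulg_continuous.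
exact: compact_setX.
Qed.

Lemma mulg_continuousr x : continuous (fun y : G => y * x).
Proof.
move=> y; apply: (@continuous_comp _ _ _ (fun z => (z, x))
  (fun z : G * G => z.1 * z.2)).
  by apply: cvg_pair => //; exact: cvg_cst.
exact: mulg_continuous.
Qed.

Lemma mulg_continuousl x : continuous (fun y : G => x * y).
Proof.
move=> y; apply: (@continuous_comp _ _ _ (fun z => (x, z))
  (fun z : G * G => z.1 * z.2)).
  by apply: cvg_pair => //; exact: cvg_cst.
exact: mulg_continuous.
Qed.

Lemma image_mulgr A x : [set a * x | a in A] = (fun y => y * x^-1) @^-1` A.
Proof.
apply/seteqP; split=> [_ [a Aa <-]|y Ay]; first by rewrite /= mulgK.
by exists (y * x^-1) => //; rewrite mulgVK.
Qed.

Lemma image_mulgl A x : [set x * a | a in A] = (fun y => x^-1 * y) @^-1` A.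
Proof.
apply/seteqP; split=> [_ [a Aa <-]|y Ay]; first by rewrite /= mulKg.
by exists (x^-1 * y) => //; rewrite mulVKg.
Qed.

Lemma open_mulgr A x : open A -> open [set a * x | a in A].
Proof.
move=> oA; rewrite image_mulgr.
by move/continuousP: (@mulg_continuousr (x^-1)); apply.
Qed.

Lemma open_mulgl A x : open A -> open [set x * a | a in A].
Proof.
move=> oA; rewrite image_mulgl.
by move/continuousP: (@mulg_continuousl (x^-1)); apply.
Qed.

Lemma subgroup_setMg K L : subgroup K -> subgroup L ->
  setMg K L = setMg L K -> subgroup (setMg K L).
Proof.
move=> [K1 KM KV] [L1 LM LV] KL; split.
- by exists 1 => //; exists 1 => //; rewrite mul1g.
- move=> _ _ [k Kk [l Ll <-]] [k' Kk' [l' Ll' <-]].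
  have : setMg L K (l * k') by exists l => //; exists k'.
  rewrite -KL => -[k2 Kk2 [l2 Ll2 kl2]].
  exists (k * k2); first exact: KM.
  exists (l2 * l'); first exact: LM.
  by rewrite -mulgA (mulgA k2) kl2 !mulgA.
- move=> _ [k Kk [l Ll <-]]; rewrite KL invgM.
  by exists l^-1; [exact: LV|exists k^-1 => //; exact: KV].
Qed.

Lemma subgroup1 : subgroup [set (1 : G)].
Proof. by split=> [//|x y -> ->|x ->]; rewrite ?mulg1 ?invg1. Qed.

Lemma open_subgroup_closed K : subgroup K -> open K -> closed K.
Proof.
move=> [K1 KM KV] oK; rewrite -openC.
(* The complement is the union of the other left cosets. *)
have -> : ~` K = \bigcup_(x in ~` K) [set x * a | a in K].
  apply/seteqP; split=> [x nKx|_ [x nKx [a Ka <-]] Kxa].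
    by exists x => //; exists 1 => //; rewrite mulg1.
  by apply: nKx; rewrite -(mulgK a x); apply: KM => //; exact: KV.
by apply: bigcup_open => x _; exact: open_mulgl.
Qed.

Lemma subgroup_open K : subgroup K -> nbhs 1 K -> open K.
Proof.
move=> [K1 KM KV] nK; rewrite openE => x Kx.
have : nbhs x [set x * a | a in K°].
  apply: open_nbhs_nbhs; split; first exact/open_mulgl/open_interior.
  by exists 1; rewrite ?mulg1.
apply: filterS => _ [a /interior_subset Ka <-]; exact: KM.
Qed.

Section compactly_covered_quasihamiltonian.
Hypotheses (hausG : hausdorff_space G) (ccG : compactly_covered G).
Hypothesis (qhG : topologically_quasihamiltonian G).

(** Products of compact sets are compact, hence closed, so that quasinormality
    says KL = LK without closures. *)
Lemma compact_subgroup_setMg K L : subgroup K -> subgroup L ->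
  compact K -> compact L -> subgroup (setMg K L).
Proof.
move=> sK sL cK cL; apply: subgroup_setMg => //.
have [_] := qhG (conj sK (compact_closed hausG cK)).
move=> /(_ L (conj sL (compact_closed hausG cL))).
by rewrite -!(iffLR (closure_id _)) //; apply: compact_closed => //;
  exact: compact_setMg.
Qed.

Lemma finite_sub_compact_subgroup (s : seq G) :
  exists K, [/\ subgroup K, compact K & forall x, x \in s -> K x].
Proof.
elim: s => [|x s [K [sK cK Ks]]].
  by exists [set 1]; split=> //; [exact: subgroup1|exact: compact_set1].
have [L [sL cL Lx]] := ccG x.
exists (setMg L K); split; [exact: compact_subgroup_setMg|exact: compact_setMg|].
move=> y; rewrite inE => /predU1P[->|ys].
  by exists x => //; exists 1; [case: sK|rewrite mulg1].
by exists 1; [case: sL|exists y; [exact: Ks|rewrite mul1g]].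
Qed.

(** Enlarge A to a compact symmetric neighbourhood C of 1. By compactness CC
    is covered by finitely many translates of C, so CC is contained in KC for a
    compact subgroup K. Then S = KC is stable under right multiplication by C,
    and the elements whose right multiplications preserve S, together with
    their inverses, form a subgroup between C and S. *)
Lemma compact_sub_open_subgroup (lcG : locally_compact [set: G]) A :
  compact A -> exists H, [/\ subgroup H, compact H, open H & A `<=` H].
Proof.
move=> cA; have [W + [cW _]] := lcG 1 I.
rewrite within_interior ?interiorT // => nW.
pose B := A `|` W; pose C := B `|` [set x^-1 | x in B].
have cB : compact B by exact: compactU.
have cC : compact C.
  apply: compactU => //; apply: continuous_compact => //.
  by apply: continuous_subspaceT; exact: invg_continuous.
have nC : nbhs 1 C by apply: filterS nW => x Wx; left; right.
have C1 : C 1 := nbhs_singleton nC.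
have CV x : C x -> C x^-1.
  by move=> [Bx|[y By <-]]; [right; exists x|left; rewrite invgK].
have [D _ CD] : finite_subset_cover (setMg C C)
    (fun x => [set x * a | a in C°]) (setMg C C).
  have := compact_setMg cC cC; rewrite compact_cover; apply.
    by move=> x _; exact/open_mulgl/open_interior.
  by move=> x CCx; exists x => //; exists 1; rewrite ?mulg1.
have [K [[K1 KM KV] cK KD]] := finite_sub_compact_subgroup (finmap.enum_fset D).
pose S := setMg K C.
have SC x y : S x -> C y -> S (x * y).
  move=> [k Kk [c Cc <-]] Cy.
  have /CD[d /= Dd [v /interior_subset Cv cy]] : setMg C C (c * y).
    by exists c => //; exists y.
  exists (k * d); first by apply: KM => //; exact: KD.
  by exists v => //; rewrite -mulgA cy mulgA.
have S1 : S 1 by exists 1 => //; exists 1 => //; rewrite mul1g.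
pose H : set G := [set x | forall y, S y -> S (y * x) /\ S (y * x^-1)].
have sH : subgroup H.
  split=> [y Sy|x x' Hx Hx' y Sy|x Hx y Sy]; first by rewrite invg1 mulg1.
    by rewrite invgM !mulgA; split; [apply Hx', Hx|apply Hx, Hx'].
  by rewrite invgK; split; apply Hx.
have CH : C `<=` H by move=> x Cx y Sy; split; apply: SC => //; exact: CV.
have oH : open H by apply: subgroup_open => //; exact: filterS nC.
exists H; split=> //.
  apply: (@subclosed_compact _ _ S); first exact: open_subgroup_closed.
    exact: compact_setMg.
  by move=> x /(_ 1 S1)[]; rewrite mul1g.
by move=> x Ax; apply: CH; left; left.
Qed.

End compactly_covered_quasihamiltonian.

(** * Trajectories *)

Section trajectory.
Variable phi : G -> G.

Lemma trajectoryS U V n : U `<=` V ->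
  trajectory phi U n `<=` trajectory phi V n.
Proof.
move=> UV; elim: n => //= n IHn.
by apply: setMgS => //; exact: image_subset.
Qed.

Lemma iter_morph n :
  {morph phi : x y / x * y} -> {morph iter n phi : x y / x * y}.
Proof. by move=> phiM; elim: n => // n IHn x y; rewrite /= IHn phiM. Qed.

Lemma iter_morph1 n : {morph phi : x y / x * y} -> iter n phi 1 = 1.
Proof.
move=> /(iter_morph n) iterM; apply: (mulgI (iter n phi 1)).
by rewrite -iterM !mulg1.
Qed.

Lemma iter_continuous n : continuous phi -> continuous (iter n phi).
Proof.
move=> cphi; elim: n => [|n IHn] x /=; first exact: cvg_id.
by apply: (@continuous_comp _ _ _ (iter n phi) phi); [exact: IHn|exact: cphi].
Qed.

Lemma compact_trajectory U n : continuous phi -> compact U ->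
  compact (trajectory phi U n).
Proof.
move=> cphi cU; elim: n => /= [|n IHn]; first exact: compact_set1.
apply: compact_setMg => //; apply: continuous_compact => //.
by apply: continuous_subspaceT; exact: iter_continuous.
Qed.

Lemma trajectory_add U m n : {morph phi : x y / x * y} ->
  trajectory phi U (m + n) =
  setMg (trajectory phi U m) (iter m phi @` trajectory phi U n).
Proof.
move=> phiM; have iterM := iter_morph m phiM.
elim: n => [|n IHn]; first rewrite addn0 /=.
  rewrite image_set1 iter_morph1 //.
  apply/seteqP; split=> [x Ux|_ [x Ux [_ -> <-]]]; last by rewrite mulg1.
  by exists x => //; exists 1; rewrite ?mulg1.
rewrite addnS /= IHn image_setMg // setMgA image_comp.
by congr (setMg _ _); apply: eq_imagel => x _ /=; rewrite iterD.
Qed.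

(** The blocks of [m] consecutive factors of a long trajectory are the images
    of the first block under the powers of [iter m phi]. *)
Lemma trajectory_iter U m n : {morph phi : x y / x * y} ->
  trajectory (iter m phi) (trajectory phi U m) n = trajectory phi U (n * m).
Proof.
move=> phiM; elim: n => [//|n IHn] /=.
rewrite mulSnr trajectory_add // IHn; congr (setMg _ _).
by apply: eq_imagel => x _; rewrite iterM.
Qed.

Lemma le_trajectory U i j : {morph phi : x y / x * y} -> U 1 -> (i <= j)%N ->
  trajectory phi U i `<=` trajectory phi U j.
Proof.
move=> phiM U1 /subnK <-; elim: (j - i)%N => [//|k IHk] x /IHk Ux /=.
exists x => //; exists 1; last by rewrite mulg1.
by exists 1 => //; exact: iter_morph1.
Qed.

Lemma trajectory1 U : trajectory phi U 1 = U.
Proof. by rewrite /= setMg1A image_id. Qed.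

Lemma sub_trajectory U n : {morph phi : x y / x * y} -> U 1 -> (0 < n)%N ->
  U `<=` trajectory phi U n.
Proof.
by move=> phiM U1 n0; rewrite -[X in X `<=` _]trajectory1; exact: le_trajectory.
Qed.

End trajectory.

Lemma trajectory_id_subgroup K n : subgroup K -> trajectory id K n.+1 = K.
Proof.
move=> [K1 KM _]; elim: n => [|n IHn]; first exact: trajectory1.
have -> : trajectory id K n.+2 =
  setMg (trajectory id K n.+1) (iter n.+1 id @` K) by [].
rewrite IHn; have -> : iter n.+1 id = id :> (G -> G).
  by apply/funext => x; elim: n {IHn} => //= n.
rewrite image_id; apply/seteqP; split=> [_ [x Kx [y Ky <-]]|x Kx].
  exact: KM.
by exists x => //; exists 1; rewrite ?mulg1.
Qed.

End groups.

(** * Haar measure and entropy *)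

Section haar.
Context {R : realType} {G : topologicalGroupType}.
Variable mu : {measure set (borel G) -> \bar R}.
Hypotheses (hausG : hausdorff_space G) (haar_mu : right_haar_measure mu).
Local Open Scope ereal_scope.
Implicit Types K U V : set G.

Lemma open_measurable_borel U : open U -> measurable (U : set (borel G)).
Proof. by move=> oU; exact: sub_sigma_algebra. Qed.

Lemma closed_measurable_borel K : closed K -> measurable (K : set (borel G)).
Proof.
move=> cK; rewrite -[K]setCK; apply: measurableC.
by apply: open_measurable_borel; exact: closed_openC.
Qed.

Lemma compact_measurable_borel K : compact K -> measurable (K : set (borel G)).
Proof. by move=> /(compact_closed hausG) /closed_measurable_borel. Qed.

(** Finitely many translates of [V] cover a given compact set, so if [V] were
    null then all compact sets would be null, and the whole group too by inner
    regularity. *)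
Lemma haar_open_gt0 V : open V -> V 1%g -> 0 < mu V.
Proof.
move=> oV V1; rewrite lt_neqAle measure_ge0 andbT eq_sym.
apply: contra_notN (negP (haar_neq0 haar_mu)) => /eqP V0; apply/eqP.
rewrite (haar_inner_regular haar_mu openT).
apply/eqP; rewrite eq_le; apply/andP; split; last first.
  rewrite -(measure0 mu); apply: ereal_sup_ubound; exists set0 => //.
  by split=> //; exact: compact0.
apply: ge_ereal_sup => _ [K [cK _] <-].
have [D _ KD] : finite_subset_cover setT (fun x => [set (a * x)%g | a in V]) K.
  rewrite compact_cover in cK; apply: cK.
    by move=> x _; exact: open_mulgr.
  by move=> x Kx; exists x => //; exists 1%g; rewrite ?mul1g.
have muK := @content_sub_fsum _ _ _ mu _ _ K
  (fun x => [set (a * x)%g | a in V]) (finite_fset D).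
apply: le_trans (muK _ _ KD) _.
- by move=> x _; apply: open_measurable_borel; exact: open_mulgr.
- exact: compact_measurable_borel.
rewrite fsbig1 // => x _.
have := haar_right_invariant haar_mu x (open_measurable_borel oV).
by move=> /= ->.
Qed.

Lemma haar_nbhs_gt0 U : compact U -> nbhs 1%g U -> 0 < mu U.
Proof.
move=> cU nU; have := @haar_open_gt0 (U°) (open_interior U).
have /nbhs_singleton := nbhs_interior nU.
move=> /[swap] /[apply] /lt_le_trans; apply.
apply: le_measure; rewrite ?inE; last exact: interior_subset.
  by apply: open_measurable_borel; exact: open_interior.
exact: compact_measurable_borel.
Qed.

Lemma le_haar_compact K L : compact K -> compact L -> K `<=` L -> mu K <= mu L.
Proof.
move=> cK cL KL.
by apply: le_measure; rewrite ?inE //; exact: compact_measurable_borel.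
Qed.

Lemma haar_in_itv K : mu K \in `[0, +oo].
Proof. by rewrite in_itv /= measure_ge0 leey. Qed.

Section entropy.
Variable phi : G -> G.
Hypotheses (cphi : continuous phi).

Lemma le_Halg U V : compact U -> compact V -> U `<=` V ->
  Halg mu phi U <= Halg mu phi V.
Proof.
move=> cU cV UV; apply: le_limn_esup; apply: nearW => n.
apply: lee_wpmul2r; first by rewrite lee_fin.
rewrite lee_lne ?haar_in_itv //.
apply: le_haar_compact; last exact: trajectoryS;
  exact: compact_trajectory.
Qed.

Hypothesis phiM : {morph phi : x y / (x * y)%g}.

Lemma Halg_iter U m : compact U -> nbhs 1%g U -> (0 < m)%N ->
  Halg mu (iter m phi) (trajectory phi U m) = m%:R%:E * Halg mu phi U.
Proof.
move=> cU nU m0; have U1 : U 1%g := nbhs_singleton nU.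
have muT k : (0 < k)%N -> 0 < mu (trajectory phi U k) < +oo.
  move=> k0; rewrite (haar_compact_fin haar_mu); last exact: compact_trajectory.
  rewrite andbT (lt_le_trans (haar_nbhs_gt0 cU nU)) //.
  apply: le_haar_compact => //; first exact: compact_trajectory.
  exact: sub_trajectory.
pose a k : R := ln (fine (mu (trajectory phi U k))).
have aE k : (0 < k)%N -> lne (mu (trajectory phi U k)) = (a k)%:E.
  move=> k0; have /andP[mu0 muoo] := muT k k0.
  rewrite -[in LHS](@fineK _ (mu _)) ?ge0_fin_numE ?measure_ge0 //.
  by rewrite lne_EFin // fine_gt0 // mu0.
have amono i j : (0 < i <= j)%N -> (a i <= a j)%R.
  move=> /andP[i0 ij]; have j0 := leq_trans i0 ij.
  rewrite -lee_fin -!aE // lee_lne ?haar_in_itv //.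
  apply: le_haar_compact; last exact: le_trajectory;
    exact: compact_trajectory.
rewrite /Halg.
under eq_fun => n do rewrite trajectory_iter // aE ?muln_gt0 //.
under [in RHS]eq_fun => n do rewrite aE //.
exact: limn_esup_multiples.
Qed.

End entropy.
End haar.

Section identity_entropy.
Context {R : realType} {G : topologicalGroupType}.
Variable mu : {measure set (borel G) -> \bar R}.
Hypotheses (hausG : hausdorff_space G) (haar_mu : right_haar_measure mu).
Local Open Scope ereal_scope.

Lemma Halg_id_subgroup (H : set G) : subgroup H -> compact H -> nbhs 1%g H ->
  Halg mu id H = 0.
Proof.
move=> sH cH nH; rewrite /Halg.
under eq_fun do rewrite trajectory_id_subgroup //.
have muH : mu H \is a fin_num.
  by rewrite ge0_fin_numE ?measure_ge0 //; exact: (haar_compact_fin haar_mu).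
have muH0 : (0 < fine (mu H))%R.
  by rewrite -lte_fin fineK //; exact: haar_nbhs_gt0.
rewrite -[mu H]fineK // lne_EFin //; set c := ln _.
have cvg0 : (fun n => c * n.+1%:R^-1)%R @ \oo --> (0 : R)%R.
  rewrite -[X in _ --> X](mulr0 c).
  by apply: cvgM; [exact: cvg_cst|exact: cvg_harmonic].
have : (fun n => (c * n.+1%:R^-1)%:E) @ \oo --> 0%:E.
  by apply: cvg_EFin cvg0; exact: nearW.
by move=> /cvg_limn_einf_sup[].
Qed.

End identity_entropy.

Theorem lemma4p3 (R : realType) (G : topologicalGroupType)
    (hausG : hausdorff_space G)
    (lcG : locally_compact [set: G])
    (ccG : compactly_covered G)
    (qhG : topologically_quasihamiltonian G)
    (mu : {measure set (borel G) -> \bar R}) (haar_mu : right_haar_measure mu)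
    (phi : {multiplicative G -> G}) (cphi : continuous phi) (m : nat) :
  (halg mu (iter m phi) = m%:R%:E * halg mu phi)%E.
Proof.
have phiM : {morph phi : x y / (x * y)%g} by exact: gmulfM.
have [->|m0] := posnP m.
  have Halg0 (U : set G) : compact U -> exists H,
      [/\ compact H, nbhs 1%g H, U `<=` H & Halg mu id H = 0%E].
    move=> cU.
    have [H [sH cH oH UH]] := compact_sub_open_subgroup hausG ccG qhG lcG cU.
    have nH : nbhs 1%g H by apply: open_nbhs_nbhs; split => //; case: sH.
    by exists H; split=> //; exact: Halg_id_subgroup.
  rewrite mul0e; apply/eqP; rewrite eq_le; apply/andP; split.
    apply: ge_ereal_sup => _ [U [cU _] <-].
    have [H [cH _ UH <-]] := Halg0 _ cU.
    by apply: le_Halg => // x; exact: cvg_id.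
  have [H [cH nH _ <-]] := Halg0 _ (@compact0 G).
  by apply: ereal_sup_ubound; exists H.
have mR : (0 < m%:R :> R) by rewrite ltr0n.
apply/eqP; rewrite eq_le; apply/andP; split.
  apply: ge_ereal_sup => _ [U [cU nU] <-].
  have U1 : U 1%g := nbhs_singleton nU.
  apply: (@le_trans _ _ (Halg mu (iter m phi) (trajectory phi U m))).
    apply: le_Halg => //; [exact: iter_continuous|exact: compact_trajectory|].
    exact: sub_trajectory.
  rewrite Halg_iter // lee_pmul2l ?lte_fin //.
  by apply: ereal_sup_ubound; exists U.
rewrite -lee_pdivlMl //; apply: ge_ereal_sup => _ [U [cU nU] <-].
have U1 : U 1%g := nbhs_singleton nU.
rewrite lee_pdivlMl // -Halg_iter //; apply: ereal_sup_ubound.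
exists (trajectory phi U m) => //; split; first exact: compact_trajectory.
by apply: filterS nU; exact: sub_trajectory.
Qed.
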